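(* Let $\mathscr{C}$ be a monadically dependent class of finite simple undirected graphs. Then the following conditions are equivalent: (1) $\mathscr{C}$ has a stable edge relation; (2) $\mathscr{C}$ is stable; (3) $\mathscr{C}$ is monadically stable.
   Context: Graphs are relational structures with one binary edge relation $E$. A monadic expansion of a class $\mathscr{C}$ is a class obtained by adding, for a fixed finite set $\Sigma$ of unary relation symbols, interpretations of these symbols (as vertex subsets) to graphs of $\mathscr{C}$. A first-order formula $\phi(\bar x,\bar y)$ is unstable on a class $\mathscr{C}$ if for every $n\ge1$ there are $G\in\mathscr{C}$ and tuples $\bar a^1,\dots,\bar a^n$, $\bar b^1,\dots,\bar b^n$ with $G\models\phi(\bar a^i,\bar b^j)$ iff $i\le j$; otherwise stable. $\phi(\bar x,\bar y)$ is independent on $\mathscr{C}$ if for every $n\ge1$ there are $G\in\mathscr{C}$, tuples $\bar a^1,\dots,\bar a^n$ and tuples $\bar b^J$ for all $J\subseteq[n]$ with $G\models\phi(\bar a^i,\bar b^J)$ iff $i\in J$; otherwise dependent. The class $\mathscr{C}$ has a stable edge relation if $E(x,y)$ is stable on $\mathscr{C}$; it is stable if every first-order formula is stable on it; monadically stable if every monadic expansion is stable; it is dependent if every formula is dependent on it, and monadically dependent if every monadic expansion of it is dependent. *)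

(* Defs.v *)
From mathcomp Require Import all_boot.

Set Implicit Arguments.
Unset Strict Implicit.
Unset Printing Implicit Defensive.

Record graph := Graph {
  vertex :> finType;
  edge : rel vertex;
  edge_sym : symmetric edge;
  edge_irr : irreflexive edge }.

Record colored_graph (Sigma : finType) := ColoredGraph {
  base :> graph;
  color : Sigma -> {set base} }.

(** First-order formulas in the language [{E}] extended by the unary symbols
    [Sigma], with free variables among ['I_n].  A quantifier binds variable 0
    and shifts the others; the remaining connectives and the universal
    quantifier are definable classically. *)
Inductive formula (Sigma : finType) : nat -> Type :=
| Eq n of 'I_n & 'I_n : formula Sigma n
| Edge n of 'I_n & 'I_n : formula Sigma n
| Color n of Sigma & 'I_n : formula Sigma n
| Not n of formula Sigma n : formula Sigma n
| And n of formula Sigma n & formula Sigma n : formula Sigma n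
| Ex n of formula Sigma n.+1 : formula Sigma n.

(** Satisfaction is boolean because all structures are finite. *)
Fixpoint sat (Sigma : finType) (M : colored_graph Sigma) (n : nat)
    (phi : formula Sigma n) : n.-tuple M -> bool :=
  match phi in formula _ n return n.-tuple M -> bool with
  | Eq _ i j => fun e => tnth e i == tnth e j
  | Edge _ i j => fun e => edge (tnth e i) (tnth e j)
  | Color _ s i => fun e => tnth e i \in color M s
  | Not _ psi => fun e => ~~ sat psi e
  | And _ psi chi => fun e => sat psi e && sat chi e
  | Ex _ psi => fun e => [exists x : M, sat psi [tuple of x :: e]]
  end.

Section Classes.
Variables (Sigma : finType) (D : colored_graph Sigma -> Prop).

(** A formula [phi(x, y)] with [|x| = p] and [|y| = q] is a formula whose first
    [p] variables are [x] and whose last [q] variables are [y]. *)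
Definition unstable (p q : nat) (phi : formula Sigma (p + q)) : Prop :=
  forall n : nat, 0 < n ->
  exists M : colored_graph Sigma, D M /\
  exists (a : 'I_n -> p.-tuple M) (b : 'I_n -> q.-tuple M),
    forall i j : 'I_n, sat phi [tuple of a i ++ b j] <-> i <= j.

Definition independent (p q : nat) (phi : formula Sigma (p + q)) : Prop :=
  forall n : nat, 0 < n ->
  exists M : colored_graph Sigma, D M /\
  exists (a : 'I_n -> p.-tuple M) (b : {set 'I_n} -> q.-tuple M),
    forall (i : 'I_n) (J : {set 'I_n}),
      sat phi [tuple of a i ++ b J] <-> i \in J.

Definition stable_formula (p q : nat) (phi : formula Sigma (p + q)) : Prop :=
  ~ unstable phi.

Definition dependent_formula (p q : nat) (phi : formula Sigma (p + q)) : Prop :=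
  ~ independent phi.

Definition stable_colored : Prop :=
  forall (p q : nat) (phi : formula Sigma (p + q)), stable_formula phi.

Definition dependent_colored : Prop :=
  forall (p q : nat) (phi : formula Sigma (p + q)), dependent_formula phi.

End Classes.

(** The same graph may receive several colorings in [D]. *)
Definition monadic_expansion (C : graph -> Prop) (Sigma : finType)
    (D : colored_graph Sigma -> Prop) : Prop :=
  (forall M : colored_graph Sigma, D M -> C (base M)) /\
  (forall G : graph, C G ->
     exists c : Sigma -> {set G}, D (ColoredGraph c)).

(** A class of graphs seen as a class of structures without unary symbols. *)
Definition uncolored (C : graph -> Prop) : colored_graph void -> Prop :=
  fun M => C (base M).

Definition stable (C : graph -> Prop) : Prop := stable_colored (uncolored C).

Definition monadically_stable (C : graph -> Prop) : Prop :=
  forall (Sigma : finType) (D : colored_graph Sigma -> Prop),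
    monadic_expansion C D -> stable_colored D.

Definition monadically_dependent (C : graph -> Prop) : Prop :=
  forall (Sigma : finType) (D : colored_graph Sigma -> Prop),
    monadic_expansion C D -> dependent_colored D.

(** The formula [E(x, y)], with [x] and [y] of length 1. *)
Definition edge_formula : formula void (1 + 1) :=
  Edge void (lshift 1 ord0) (rshift 1 ord0).

Definition stable_edge_relation (C : graph -> Prop) : Prop :=
  stable_formula (uncolored C) edge_formula.

(* Main.v *)
(** Assume that [C] is monadically dependent with a stable edge relation.  By
    induction on a formula [phi] one bounds the length of the sequences of tuples
    on which some splitting of the variables of [phi] into [x] and [y] defines the
    strict order; atomic formulas are clear and a conjunction is handled by Ramsey.
    Suppose that [exists z, psi z x y] orders a long sequence [a], with witnesses
    [d i j] for [i < j].  By Ramsey, [psi (d i j) (a k) (a l)] may be assumed to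
    depend only on the order type of [(i, j, k, l)].  If this truth value changes
    when two adjacent indices are exchanged, then [psi] itself orders a long
    sequence, made of points [d] and tuples [a].  Otherwise, as it is false for
    [l < k], it is true only for [(k, l) = (i, j)]; then colouring a set of the
    points [d i j] codes an arbitrary bipartite graph between the tuples [a i] and
    [a j], against monadic dependence. *)
Require Import Defs.
From mathcomp Require Import all_boot zify.
From Stdlib Require Import Classical.

Set Implicit Arguments.
Unset Strict Implicit.
Unset Printing Implicit Defensive.

(** * Ramsey's theorem for sequences and for indices *)

Section Ramsey.
Variables (T : eqType) (K : finType).
Implicit Types (col : seq T -> K) (X Y Z t : seq T).

(** The colour of a [k.+1]-element subsequence depends only on its first element. *)
Fixpoint prehomogeneous k col Y : Prop :=
  if Y is x :: Y' then
    (exists c, forall t, subseq t Y' -> size t = k -> col (x :: t) = c)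
    /\ prehomogeneous k col Y'
  else True.

(** Each element joins the class of the colour that it gives as a head; the sizes are summed with a
    view to a pigeonhole argument. *)
Lemma prehomogeneous_split k col Y : prehomogeneous k col Y ->
  exists Z : K -> seq T, [/\ forall c, subseq (Z c) Y,
    \sum_c size (Z c) = size Y &
    forall c t, subseq t (Z c) -> size t = k.+1 -> col t = c].
Proof.
elim: Y => [_|x Y IH [[c0 colx] /IH[Z [subZ sumZ homZ]]]].
  exists (fun=> [::]); split=> [c||c t]; first by rewrite sub0seq.
    by rewrite big1.
  by rewrite subseq0 => /eqP->.
exists (fun c => if c == c0 then x :: Z c else Z c); split=> [c||c t].
- case: ifP => _; first by rewrite /= eqxx.
  exact: subseq_trans (subZ c) (subseq_cons _ _).
- rewrite /= -sumZ (bigD1 c0) //= eqxx [in RHS](bigD1 c0) //= addSn.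
  by congr (_ + _).+1; apply: eq_bigr => c /negPf->.
case: eqP => [->|_]; last exact: homZ.
case: t => //= y t; case: eqP => [-> tZ [szt]|_ tZ szt].
  by apply: colx => //; apply: subseq_trans (subZ c0).
exact: homZ.
Qed.

Lemma ramsey_seq k N : exists R, forall col X, R <= size X ->
  exists c Y, [/\ subseq Y X, size Y = N &
    forall t, subseq t Y -> size t = k -> col t = c].
Proof.
elim: k N => [N|k IH N].
  exists N => col X leNX; exists (col [::]), (take N X).
  split=> [||[]//]; first exact: take_subseq.
  by rewrite size_takel.
(* Heads are taken one at a time, with the case [k] applied to the colouring [col (x :: _)] of what
   follows; the length forces some class to exceed [N]. *)
have [R preR] : exists R, forall col X, R <= size X ->
    exists Y, [/\ subseq Y X, size Y = (#|K| * N).+1 & prehomogeneous k col Y].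
  elim: (#|K| * N).+1 => [|m [R preR]].
    by exists 0 => col X _; exists [::]; rewrite sub0seq.
  have [R' ramR] := IH R; exists R'.+1 => col [|x X] //= leRX.
  have [c [Y [YX szY colY]]] := ramR (fun t => col (x :: t)) X leRX.
  have [Z [ZY szZ preZ]] := preR col Y (eq_leq (esym szY)).
  exists (x :: Z); split; rewrite /= ?eqxx ?szZ //.
    exact: subseq_trans YX.
  by split=> //; exists c => t tZ; apply: colY; apply: subseq_trans ZY.
exists R => col X /(preR col)[Y [YX szY /prehomogeneous_split[Z [ZY sumZ homZ]]]].
have [c ltNZ] : exists c, N < size (Z c).
  apply/existsP; apply: contraT; rewrite negb_exists => /forallP leZN.
  have: \sum_c size (Z c) <= \sum_(c : K) N.
    by apply: leq_sum => c _; rewrite leqNgt.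
  by rewrite sumZ szY sum_nat_const ltnn.
exists c, (take N (Z c)); split=> [||t tZ].
- exact: subseq_trans (take_subseq _ _) (subseq_trans (ZY c) YX).
- by rewrite size_takel // ltnW.
by apply: homZ; apply: subseq_trans tZ (take_subseq _ _).
Qed.

End Ramsey.

Lemma ramsey (K : finType) k N : exists R, forall col : seq nat -> K,
  exists h c, [/\ forall x y, x < y -> y < N -> h x < h y,
    forall x, x < N -> h x < R &
    forall s, sorted ltn s -> all (gtn N) s -> size s = k ->
      col (map h s) = c].
Proof.
have [R ramR] := ramsey_seq nat K k N.
exists R => col; have [|c [Y [YX szY colY]]] := ramR col (iota 0 R).
  by rewrite size_iota.
exists (nth 0 Y), c.
have sortY : sorted ltn Y.
  exact: subseq_sorted ltn_trans _ _ YX (iota_ltn_sorted _ _).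
split=> [x y ltxy ltyN|x ltxN|s sorts sN szs].
- by apply: (sorted_ltn_nth ltn_trans 0 sortY) => //; rewrite inE szY //; lia.
- have: nth 0 Y x \in Y by rewrite mem_nth ?szY.
  by move/(mem_subseq YX); rewrite mem_iota.
apply: colY; rewrite ?size_map //.
rewrite -{2}[Y](mkseq_nth 0) szY; apply: map_subseq.
(* Written as a filter of [iota 0 N], the list [s] has a subsequence of [Y] as its image. *)
have -> : s = [seq x <- iota 0 N | x \in s].
  apply: (irr_sorted_eq ltn_trans ltnn) => //.
    exact: sorted_filter ltn_trans _ _ (iota_ltn_sorted _ _).
  move=> x; rewrite mem_filter mem_iota andbC.
  by case: (boolP (x \in s)) => [/(allP sN)/= ->|]; rewrite ?andbF.
exact: filter_subseq.
Qed.

(** [q i j k l] is meant for [i < j] and [k < l]; the patterns listed are those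
    where [i] and [k] lie below [j] and [l] and [(i, j) != (k, l)]. *)
Lemma ramsey_patterns P : exists R, forall q : nat -> nat -> nat -> nat -> bool,
  exists (h : nat -> nat) (A1 A2 A3 A4 B1 B2 B3 B4 : bool),
  [/\ forall x y, x < y -> y < P -> h x < h y,
    forall x, x < P -> h x < R,
    forall x y z, x < y -> y < z -> z < P ->
      [/\ q (h x) (h y) (h x) (h z) = A1, q (h x) (h z) (h x) (h y) = A2,
          q (h x) (h z) (h y) (h z) = A3 & q (h y) (h z) (h x) (h z) = A4] &
    forall x y z w, x < y -> y < z -> z < w -> w < P ->
      [/\ q (h x) (h z) (h y) (h w) = B1, q (h x) (h w) (h y) (h z) = B2,
          q (h y) (h z) (h x) (h w) = B3 & q (h y) (h w) (h x) (h z) = B4]].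
Proof.
have [R4 ram4] := ramsey (bool * bool * bool * bool)%type 4 P.
have [R ram3] := ramsey (bool * bool * bool * bool)%type 3 R4.
exists R => q.
have [h3 [[[[A1 A2] A3] A4] [mono3 lt3 hom3]]] := ram3 (fun t =>
  let x := nth 0 t 0 in let y := nth 0 t 1 in let z := nth 0 t 2 in
  (q x y x z, q x z x y, q x z y z, q y z x z)).
have [h4 [[[[B1 B2] B3] B4] [mono4 lt4 hom4]]] := ram4 (fun t =>
  let x := h3 (nth 0 t 0) in let y := h3 (nth 0 t 1) in
  let z := h3 (nth 0 t 2) in let w := h3 (nth 0 t 3) in
  (q x z y w, q x w y z, q y z x w, q y w x z)).
exists (h3 \o h4), A1, A2, A3, A4, B1, B2, B3, B4; split=> /=.
- by move=> x y xy yP; apply: mono3; [apply: mono4|apply: lt4].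
- by move=> x xP; apply/lt3/lt4.
- move=> x y z xy yz zP; have yP := ltn_trans yz zP.
  have sorted_h : sorted ltn [:: h4 x; h4 y; h4 z] by rewrite /= !mono4.
  have all_h : all (gtn R4) [:: h4 x; h4 y; h4 z].
    by rewrite /= !lt4 // (ltn_trans xy).
  by case: (hom3 _ sorted_h all_h erefl).
- move=> x y z w xy yz zw wP; have zP := ltn_trans zw wP.
  have yP := ltn_trans yz zP.
  have sorted_s : sorted ltn [:: x; y; z; w] by rewrite /= xy yz zw.
  have all_s : all (gtn P) [:: x; y; z; w].
    by rewrite /= wP zP yP (ltn_trans xy).
  by case: (hom4 _ sorted_s all_s erefl).
Qed.

(** * Renaming of variables and colours *)

Fixpoint rename (S1 S2 : finType) (g : S1 -> S2) n (phi : formula S1 n) :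
    forall m, ('I_n -> 'I_m) -> formula S2 m :=
  match phi in formula _ n return forall m, ('I_n -> 'I_m) -> formula S2 m with
  | Eq _ i j => fun m f => Eq S2 (f i) (f j)
  | Edge _ i j => fun m f => Edge S2 (f i) (f j)
  | Color _ c i => fun m f => Color (g c) (f i)
  | Not _ psi => fun m f => Not (rename g psi f)
  | And _ psi chi => fun m f => And (rename g psi f) (rename g chi f)
  | Ex _ psi => fun m f => Ex (rename g psi
      (fun v => oapp (fun v' => lift ord0 (f v')) ord0 (unlift ord0 v)))
  end.

Lemma sat_rename (S1 S2 : finType) (g : S1 -> S2) (M : colored_graph S2)
    n (phi : formula S1 n) m (f : 'I_n -> 'I_m) (e : m.-tuple M) :
  sat (rename g phi f) e =
  sat (M := ColoredGraph (color M \o g)) phi [tuple tnth e (f v) | v < n].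
Proof.
elim: phi m f e => {n} [n i j|n i j|n c i|n psi IH|n psi IH1 chi IH2|n psi IH]
  m f e /=; rewrite ?tnth_mktuple ?IH ?IH1 ?IH2 //.
apply: eq_existsb => x; rewrite IH; congr (sat _ _).
apply: eq_from_tnth => v; rewrite tnth_mktuple.
by case: unliftP => [v' ->|->] /=; rewrite ?tnthS ?tnth0 ?tnth_mktuple.
Qed.

(** * Bounds on definable orders: atomic formulas and connectives *)

Section Order.
Variable Sigma : finType.
Implicit Types M : colored_graph Sigma.

Definition mix M n (s : 'I_n -> bool) (x y : 'I_n -> M) : n.-tuple M :=
  [tuple if s v then x v else y v | v < n].

(** [s] tells which variables of [phi] play the role of [x] in the order-defining
    relation; parameters are constant coordinates of [a]. *)
Definition orders M n (phi : formula Sigma n) (s : 'I_n -> bool)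
    (a : nat -> 'I_n -> M) N :=
  forall i j, i < N -> j < N -> i != j -> sat phi (mix s (a i) (a j)) = (i < j).

(** The bound is uniform in [s] because negation exchanges the two sides and a quantified variable
    may join either side. *)
Definition order_bounded (C : graph -> Prop) n (phi : formula Sigma n) N :=
  forall M, C M -> forall s (a : nat -> 'I_n -> M), ~ orders phi s a N.

Lemma order_boundedW C n (phi : formula Sigma n) N N' :
  N <= N' -> order_bounded C phi N -> order_bounded C phi N'.
Proof.
move=> leN bd M CM s a ord; apply: (bd M CM s a) => i j iN jN.
by apply: ord; lia.
Qed.

(** If [u] and [v] lie on different sides, [x0 = y1], [x0 = y3] and [x2 = y3] force [x2 = y1],
    although [2 < 1] fails. *)
Lemma order_bounded_eq C n (u v : 'I_n) : order_bounded C (Eq Sigma u v) 4.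
Proof.
move=> M _ s a ord; move: (ord 0 1) (ord 0 3) (ord 2 3) (ord 2 1).
rewrite /= !tnth_mktuple => /(_ isT isT isT) e01 /(_ isT isT isT) e03.
move=> /(_ isT isT isT) e23 /(_ isT isT isT).
move: e01 e03 e23; case: (s u); case: (s v) => /eqP e01 /eqP e03 /eqP e23 /eqP.
all: congruence.
Qed.

(** The truth value depends on only one of [i] and [j], whereas the index 1 has indices both above
    and below it. *)
Lemma order_bounded_color C n c (u : 'I_n) : order_bounded C (Color c u) 3.
Proof.
move=> M _ s a ord; move: (ord 0 1) (ord 1 2) (ord 1 0) (ord 2 1).
rewrite /= !tnth_mktuple => /(_ isT isT isT) e01 /(_ isT isT isT) e12.
move=> /(_ isT isT isT) e10 /(_ isT isT isT) e21.
by case: (s u) e01 e12 e10 e21 => [_ -> //|-> //].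
Qed.

(** Off the diagonal negation reverses the order, and complementing [s] reverses it back. *)
Lemma order_bounded_not C n (phi : formula Sigma n) N :
  order_bounded C phi N -> order_bounded C (Not phi) N.
Proof.
move=> bd M CM s a ord; apply: (bd M CM (fun v => ~~ s v) a) => i j iN jN ij.
have -> : mix (fun v => ~~ s v) (a i) (a j) = mix s (a j) (a i).
  by apply: eq_from_tnth => v; rewrite !tnth_mktuple if_neg.
have := ord j i jN iN; rewrite eq_sym => /(_ ij) /=; lia.
Qed.

Lemma order_bounded_and C n (phi psi : formula Sigma n) N :
  order_bounded C phi N -> order_bounded C psi N ->
  exists R, order_bounded C (And phi psi) R.
Proof.
move=> bd1 bd2; have [R ramR] := ramsey bool 2 N; exists R => M CM s a ord.
have [h [c [hmono hR hc]]] := ramR (fun t =>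
  sat phi (mix s (a (nth 0 t 1)) (a (nth 0 t 0)))).
have hc2 x y : x < y -> y < N -> sat phi (mix s (a (h y)) (a (h x))) = c.
  move=> xy yN; apply: (hc [:: x; y]) => //=; lia.
have up i j : i < j -> j < N ->
    sat phi (mix s (a (h i)) (a (h j))) && sat psi (mix s (a (h i)) (a (h j))).
  move=> ij jN; have hij := hmono _ _ ij jN.
  by have /= -> := ord (h i) (h j) (hR _ (ltn_trans ij jN)) (hR _ jN) _; lia.
have down i j : i < j -> j < N ->
    sat phi (mix s (a (h j)) (a (h i))) && sat psi (mix s (a (h j)) (a (h i)))
    = false.
  move=> ij jN; have hij := hmono _ _ ij jN.
  by have /= -> := ord (h j) (h i) (hR _ jN) (hR _ (ltn_trans ij jN)) _; lia.
(* On decreasing pairs [phi] has the constant value [c]: if true, [psi] must fail there and orders;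
   if false, [phi] orders. *)
case: c hc2 {hc} => hc; [apply: (bd2 M CM s (a \o h))|apply: (bd1 M CM s (a \o h))].
- move=> i j iN jN /=; case: ltngtP => // [ij|ji] _.
    by have /andP[] := up i j ij jN.
  by have := down j i ji iN; rewrite hc.
- move=> i j iN jN /=; case: ltngtP => // [ij|ji] _.
    by have /andP[] := up i j ij jN.
  exact: hc.
Qed.

Lemma order_bounded_edge C n (u v : 'I_n) :
  stable_edge_relation C -> exists N, order_bounded C (Edge Sigma u v) N.
Proof.
move=> st; have [n0 nst] := not_all_ex_not _ _ st.
have [n0_gt0 noM] := imply_to_and _ _ nst.
(* The slack keeps the indices 0, 1, 2 available when [u] and [v] lie on the same side. *)
exists n0.*2.+3 => M CM s a ord; apply: noM.
exists (@ColoredGraph void M (fun c => match c with end)); split=> //.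
have half u' v' : (forall i j, i < n0.*2.+3 -> j < n0.*2.+3 -> i != j ->
    edge (a i u') (a j v') = (i < j)) ->
  exists (a : 'I_n0 -> 1.-tuple M) (b : 'I_n0 -> 1.-tuple M),
    forall i j : 'I_n0, sat (M := @ColoredGraph void M
      (fun c => match c with end)) edge_formula [tuple of a i ++ b j] <-> i <= j.
  (* Even against odd indices avoid the diagonal: [i <= j] iff [i.*2 < j.*2.+1]. *)
  move=> ord'; exists (fun i : 'I_n0 => [tuple of [:: a i.*2 u']]).
  exists (fun i : 'I_n0 => [tuple of [:: a i.*2.+1 v']]) => i j.
  rewrite /= /edge_formula /= !(tnth_nth (a 0 u')) /=.
  have := ltn_ord i; have := ltn_ord j => jn i_n.
  rewrite ord'; lia.
move: ord; rewrite /orders /=.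
case su: (s u); case sv: (s v) => ord.
- have := ord 1 0 isT isT isT; have := ord 1 2 isT isT isT.
  by rewrite !tnth_mktuple su sv => ->.
- apply: (half u v) => i j iN jN ij.
  by have := ord i j iN jN ij; rewrite !tnth_mktuple su sv.
- apply: (half v u) => i j iN jN ij; rewrite edge_sym.
  by have := ord i j iN jN ij; rewrite !tnth_mktuple su sv.
- have := ord 0 1 isT isT isT; have := ord 2 1 isT isT isT.
  by rewrite !tnth_mktuple su sv => ->.
Qed.

(** * The existential quantifier *)

Lemma order_bounded_cons C n (psi : formula Sigma n.+1) N M :
  order_bounded C psi N -> C M ->
  forall (s : 'I_n -> bool) (a : nat -> 'I_n -> M) (rz rx ry : bool)
    (g : nat -> M) (hx hy : nat -> nat),
  ~ (forall i j, i < N -> j < N -> i != j ->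
      sat psi [tuple of (if rz then g i else g j) ::
        mix s (a (hx (if rx then i else j))) (a (hy (if ry then i else j)))]
      = (i < j)).
Proof.
move=> bd CM s a rz rx ry g hx hy ord.
(* The witness joins the side given by [rz], the two parts of the tuple those given by [rx] and
   [ry]; a constant [g], [hx] or [hy] makes its part a parameter. *)
apply: (bd M CM
  (fun v => oapp (fun v' => if s v' then rx else ry) rz (unlift ord0 v))
  (fun i v => oapp (fun v' => a (if s v' then hx i else hy i) v') (g i)
                (unlift ord0 v))) => i j iN jN ij.
rewrite -ord //; congr (sat _ _); apply: eq_from_tnth => v.
rewrite tnth_mktuple; case: unliftP => [v' ->|->] /=; last by rewrite tnth0.
by rewrite tnthS tnth_mktuple; case: (s v'); [case: (rx)|case: (ry)].
Qed.

(** After colouring an arbitrary set of the points [d i j], the formula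
    "some coloured [z] satisfies [psi z x y]" defines an arbitrary bipartite graph
    between the tuples [a i] and [a j]. *)
Definition grid M n (psi : formula Sigma n.+1) (s : 'I_n -> bool)
    (a : nat -> 'I_n -> M) (d : nat -> nat -> M) m :=
  forall i j k l, i < m -> k < m -> m <= j < m + 2 ^ m -> m <= l < m + 2 ^ m ->
    sat psi [tuple of d i j :: mix s (a k) (a l)] = (i == k) && (j == l).

Lemma grid_bounded C n (psi : formula Sigma n.+1) s :
  monadically_dependent C ->
  exists m, forall M, C M -> forall a d, ~ @grid M n psi s a d m.
Proof.
move=> dep.
pose f (v : 'I_n.+1) : 'I_(n + n).+1 :=
  oapp (fun v' => lift ord0 (if s v' then lshift n v' else rshift n v')) ord0
    (unlift ord0 v).
pose chi : formula (option Sigma) (n + n) :=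
  Ex (And (Color None ord0) (rename Some psi f)).
(* The expansion contains all colourings of graphs of [C], so the set named by [None] can be chosen
   freely. *)
have dep_chi : dependent_colored (fun M : colored_graph (option Sigma) => C M).
  by apply: dep; split=> // G CG; exists (fun=> set0).
have [m ndep] := not_all_ex_not _ _ (dep_chi n n chi).
have [m_gt0 noM] := imply_to_and _ _ ndep.
exists m => -[G col] CM a d gr; apply: noM.
(* One column for each of the [2 ^ m] subsets. *)
pose idx (J : {set 'I_m}) := m + enum_rank J.
have idxP J : m <= idx J < m + 2 ^ m.
  rewrite /idx leq_addr ltn_add2l (leq_trans (ltn_ord _)) //.
  by rewrite -cardsT -powersetT card_powerset cardsT card_ord.
pose R := [set z | [exists i : 'I_m, [exists J : {set 'I_m},
  (i \in J) && (z == d i (idx J))]]].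
exists (ColoredGraph (fun c => oapp (col) R c)); split=> //.
exists (fun i : 'I_m => mktuple (a i)), (fun J => mktuple (a (idx J))) => i J.
have satE z : sat (M := ColoredGraph (fun c => oapp (col) R c))
    (rename Some psi f) [tuple of z :: [tuple of mktuple (a i) ++ mktuple (a (idx J))]]
    = sat psi [tuple of z :: mix s (a i) (a (idx J))].
  rewrite sat_rename.
  apply: (congr1 (@sat Sigma (ColoredGraph col) _ psi)).
  apply: eq_from_tnth => v; rewrite tnth_mktuple /f.
  case: unliftP => [v' ->|->]; rewrite /oapp ?tnth0 // !tnthS tnth_mktuple.
  by case: (s v'); rewrite ?tnth_lshift ?tnth_rshift tnth_mktuple.
rewrite /=; split=> [/existsP[z /andP[]]|iJ].
  rewrite satE tnth0 inE => /existsP[i' /existsP[J' /andP[iJ' /eqP->]]].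
  rewrite gr // => /andP[/eqP/val_inj <- /eqP/addnI/val_inj/enum_rank_inj <-] //.
apply/existsP; exists (d i (idx J)); rewrite satE gr // !eqxx !andbT tnth0 inE.
by apply/existsP; exists i; apply/existsP; exists J; rewrite iJ eqxx.
Qed.

Lemma grid_of_ex C n (psi : formula Sigma n.+1) N m :
  order_bounded C psi N ->
  exists R, forall M, C M -> forall s (a : nat -> 'I_n -> M),
    orders (Ex psi) s a R -> exists a' d, grid psi s (M := M) a' d m.
Proof.
move=> bd.
(* Room for the grid, and for [N] indices together with up to two fixed points. *)
pose P := (m + 2 ^ m + N).+4.
have [R ramR] := ramsey_patterns P.
(* The slack makes [ord 0 1] valid, whence a default point [d0] for [d]. *)
exists R.+2 => M CM s a ord.
have [d0 _] : exists d0 : M, true.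
  by have /existsP[z _] := ord 0 1 isT isT isT; exists z.
pose T z k l := sat psi [tuple of z :: mix s (a k) (a l)].
pose d i j := odflt d0 [pick z | T z i j].
have T1 i j : i < j -> j < R.+2 -> T (d i j) i j.
  move=> ij jR; rewrite /d; case: pickP => //= noz.
  have := ord i j (ltn_trans ij jR) jR; rewrite ltn_eqF ?ij // => /(_ isT).
  by move=> /= /existsP[z]; rewrite -/(T z i j) noz.
have T0 z k l : l < k -> k < R.+2 -> T z k l = false.
  move=> lk kR; have := ord k l kR (ltn_trans lk kR).
  rewrite gtn_eqF // ltnNge ltnW // => /(_ isT) /= /negbT /existsPn /(_ z).
  by rewrite -/(T z k l) => /negPf.
have [h [A1 [A2 [A3 [A4 [B1 [B2 [B3 [B4 [hmono hR hA hB]]]]]]]]]] :=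
  ramR (fun i j k l => T (d i j) k l).
have {}hR x : x < P -> h x < R.+2 by move=> xP; have := hR x xP; lia.
have win := @order_bounded_cons _ _ _ _ _ bd CM s a.
(* Each pattern is refuted by the exchange of two adjacent indices, which leads
   either to [l < k] or to a pattern already known to be false. *)
have A2F : A2 = false.
  apply/negbTE/negP => eA2.
  apply: (win true true false (fun i => d (h i) (h P.-1)) h h) => i j iN jN ij.
  rewrite -/(T _ _ _); case: ltngtP ij => // ltij _.
    by have [_ ->] := hA i j P.-1 ltij ltac:(lia) ltac:(lia).
  by apply: T0; [apply: hmono|apply: hR]; lia.
have A1F : A1 = false.
  apply/negbTE/negP => eA1.
  apply: (win true true false (fun i => d (h 0) (h i.+1)) (fun=> h 0)
            (h \o succn)) => i j iN jN ij /=.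
  rewrite -/(T _ _ _); case: ltngtP ij => // ltij _.
    by have [->] := hA 0 i.+1 j.+1 isT ltij ltac:(lia).
  by have [_ ->] := hA 0 j.+1 i.+1 isT ltij ltac:(lia).
have A3F : A3 = false.
  apply/negbTE/negP => eA3.
  apply: (win false true false (fun i => d (h 0) (h i.+1)) (h \o succn)
            (h \o succn)) => i j iN jN ij /=.
  rewrite -/(T _ _ _); case: ltngtP ij => // ltij _.
    by have [_ _ ->] := hA 0 i.+1 j.+1 isT ltij ltac:(lia).
  by apply: T0; [apply: hmono|apply: hR]; lia.
(* The witness moves with [j], and reversing [i] and [j] gives the pattern [A3]. *)
have A4F : A4 = false.
  apply/negbTE/negP => eA4.
  apply: (win false true true (fun i => d (h i) (h P.-1)) h (fun=> h P.-1))
    => i j iN jN ij /=.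
  rewrite -/(T _ _ _); case: ltngtP ij => // ltij _.
    by have [_ _ _ ->] := hA i j P.-1 ltij ltac:(lia) ltac:(lia).
  by have [_ _ ->] := hA j i P.-1 ltij ltac:(lia) ltac:(lia).
(* One fixed witness orders all tuples indexed strictly inside its interval. *)
have B2F : B2 = false.
  apply/negbTE/negP => eB2.
  apply: (win true true false (fun=> d (h 0) (h P.-1)) (h \o succn)
            (h \o succn)) => i j iN jN ij /=.
  rewrite -/(T _ _ _); case: ltngtP ij => // ltij _.
    by have [_ ->] := hB 0 i.+1 j.+1 P.-1 isT ltij ltac:(lia) ltac:(lia).
  by apply: T0; [apply: hmono|apply: hR]; lia.
have B1F : B1 = false.
  apply/negbTE/negP => eB1.
  apply: (win true true false (fun i => d (h 0) (h i.+2)) (fun=> h 1)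
            (fun i => h i.+2)) => i j iN jN ij /=.
  rewrite -/(T _ _ _); case: ltngtP ij => // ltij _.
    by have [->] := hB 0 1 i.+2 j.+2 isT isT ltij ltac:(lia).
  by have [_ ->] := hB 0 1 j.+2 i.+2 isT isT ltij ltac:(lia).
have B4F : B4 = false.
  apply/negbTE/negP => eB4.
  apply: (win false true true (fun i => d (h i) (h P.-1)) h (fun=> h P.-2))
    => i j iN jN ij /=.
  rewrite -/(T _ _ _); case: ltngtP ij => // ltij _.
    by have [_ _ _ ->] := hB i j P.-2 P.-1 ltij ltac:(lia) ltac:(lia) ltac:(lia).
  by have [_ ->] := hB j i P.-2 P.-1 ltij ltac:(lia) ltac:(lia) ltac:(lia).
have B3F : B3 = false.
  apply/negbTE/negP => eB3.
  apply: (win false true true (fun i => d (h i) (h P.-2)) h (fun=> h P.-1))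
    => i j iN jN ij /=.
  rewrite -/(T _ _ _); case: ltngtP ij => // ltij _.
    by have [_ _ ->] := hB i j P.-2 P.-1 ltij ltac:(lia) ltac:(lia) ltac:(lia).
  by have [->] := hB j i P.-2 P.-1 ltij ltac:(lia) ltac:(lia) ltac:(lia).
(* Rows lie below [m] and columns from [m] on, so only the eight refuted patterns and the diagonal
   case [T1] occur. *)
exists (a \o h), (fun i j => d (h i) (h j)) => i j k l im km.
move=> /andP[mj jm] /andP[ml lm]; rewrite -/(T _ _ _).
case: (ltngtP i k) => [ik|ki|<-]; case: (ltngtP j l) => [jl|lj|<-] /=.
- by have [->] := hB i k j l ik ltac:(lia) jl ltac:(lia).
- by have [_ ->] := hB i k l j ik ltac:(lia) lj ltac:(lia).
- by have [_ _ ->] := hA i k j ik ltac:(lia) ltac:(lia).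
- by have [_ _ ->] := hB k i j l ki ltac:(lia) jl ltac:(lia).
- by have [_ _ _ ->] := hB k i l j ki ltac:(lia) lj ltac:(lia).
- by have [_ _ _ ->] := hA k i j ki ltac:(lia) ltac:(lia).
- by have [->] := hA i j l ltac:(lia) jl ltac:(lia).
- by have [_ ->] := hA i l j ltac:(lia) lj ltac:(lia).
- by apply: T1; [apply: hmono|apply: hR]; lia.
Qed.

Lemma order_bounded_ex C n (psi : formula Sigma n.+1) N :
  monadically_dependent C -> order_bounded C psi N ->
  exists R, order_bounded C (Ex psi) R.
Proof.
move=> dep bd.
(* The grid size depends on the splitting; as finite functions the splittings are finitely many, so
   a maximum serves all. *)
have [m gr] := fin_all_exists
  (fun s : {ffun 'I_n -> bool} => grid_bounded psi s dep).
have [R RP] := fin_all_exists (fun s => grid_of_ex (m s) bd).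
exists (\max_s R s) => M CM s a ord.
have [|a' [d]] := RP (finfun s) M CM (finfun s) a; last exact: gr.
move=> i j iR jR ij.
have -> : mix (finfun s) (a i) (a j) = mix s (a i) (a j).
  by apply: eq_from_tnth => v; rewrite !tnth_mktuple ffunE.
have leR := leq_bigmax (F := R) (finfun s).
by apply: ord => //; apply: leq_trans leR.
Qed.

(** * Induction on formulas and the equivalence *)

Lemma formula_order_bounded C n (phi : formula Sigma n) :
  monadically_dependent C -> stable_edge_relation C ->
  exists N, order_bounded C phi N.
Proof.
move=> dep st; elim: phi => {n} [n u v|n u v|n c u|n psi [N bd]
  |n psi [N1 bd1] chi [N2 bd2]|n psi [N bd]].
- by exists 4; apply: order_bounded_eq.
- exact: order_bounded_edge.
- by exists 3; apply: order_bounded_color.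
- by exists N; apply: order_bounded_not.
- apply: (@order_bounded_and _ _ _ _ (maxn N1 N2)).
    exact: order_boundedW (leq_maxl _ _) bd1.
  exact: order_boundedW (leq_maxr _ _) bd2.
- exact: order_bounded_ex bd.
Qed.

End Order.

Theorem theorem1p3 (C : graph -> Prop) (hC : monadically_dependent C) :
  (stable_edge_relation C <-> stable C) /\
  (stable C <-> monadically_stable C).
Proof.
have edge_of_stable : stable C -> stable_edge_relation C by apply.
have stable_of_mon : monadically_stable C -> stable C.
  apply; split=> // G CG; exists (fun=> set0); exact: CG.
suff mon_of_edge : stable_edge_relation C -> monadically_stable C.
  by split; split=> //; [move=> /mon_of_edge | move=> /edge_of_stable]; auto.
move=> st Sigma D [DC _] p q phi unst.
have [N bd] := formula_order_bounded phi hC st.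
have [M [DM [a [b ab]]]] := unst N.+1 isT.
(* Each [a i] is joined to [b i] in one tuple; splitting at [p] recovers the pairs [a i], [b j], and
   off the diagonal [<=] is [<]. *)
apply: (bd M (DC M DM) (fun v => v < p)
  (fun i => tnth [tuple of a (inord i) ++ b (inord i)])) => i j iN jN ij.
have -> : mix (fun v : 'I_(p + q) => v < p)
    (tnth [tuple of a (inord i) ++ b (inord i)])
    (tnth [tuple of a (inord j) ++ b (inord j)])
  = [tuple of a (inord i) ++ b (inord j)].
  apply: eq_from_tnth => v; rewrite tnth_mktuple.
  have [v' ev|v' ev] := splitP v.
    have -> : v = lshift q v' by apply: val_inj.
    by rewrite !tnth_lshift.
  have -> : v = rshift p v' by apply: val_inj.
  by rewrite !tnth_rshift.
apply/idP/idP => [/ab|lt_ij]; last apply/ab; rewrite !inordK //; lia.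
Qed.
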